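(* For all $\alpha,\beta\in\mathcal{F}_{\sim}$ the following are equivalent: (1) $\alpha\vdash_{\mathcal{L}_{S}}\beta$; (2) $\alpha\vdash\beta$ is valid in the class of all Stone algebras; (3) $\alpha\vdash\beta$ is valid in the class of all Stone algebras $B^{[2]}$, $B$ ranging over all Boolean algebras; (4) $\alpha\vdash\beta$ is valid in the class of all Stone algebras $(\mathcal{P}(U))^{[2]}$, $U$ ranging over all sets.
   Context: Stone algebras: algebras $(S,\vee,\wedge,\sim,0,1)$ with $(S,\vee,\wedge,0,1)$ a bounded distributive lattice, $\sim a=\max\{c\in S: a\wedge c=0\}$ existing for every $a\in S$, and $\sim a\vee\sim\sim a=1$ for all $a$. For a Boolean algebra $B$ with complement $^{c}$, $B^{[2]}:=\{(a,b)\in B^2:a\le b\}$ with componentwise $\vee,\wedge$, $0=(0,0)$, $1=(1,1)$ and $\sim(a,b):=(b^{c},b^{c})$; this is a Stone algebra. $(\mathcal{P}(U))^{[2]}$ is the case $B=\mathcal{P}(U)$. Formulas $\mathcal{F}_{\sim}$: built from propositional variables $p,q,r,\ldots$ and constants $\top,\bot$ with binary connectives $\vee,\wedge$ and unary connective $\sim$. A consequent is an expression $\alpha\vdash\beta$ with $\alpha,\beta$ formulas. The logic $\mathcal{L}_{S}$: $\vdash_{\mathcal{L}_S}$ is the least relation on $\mathcal{F}_{\sim}$ satisfying the following postulates and rules (premises / conclusion), for all formulas. BDLL: $\alpha\vdash\alpha$; $\alpha\vdash\beta,\ \beta\vdash\gamma\,/\,\alpha\vdash\gamma$; $\alpha\wedge\beta\vdash\alpha$,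 $\alpha\wedge\beta\vdash\beta$; $\alpha\vdash\beta,\ \alpha\vdash\gamma\,/\,\alpha\vdash\beta\wedge\gamma$; $\alpha\vdash\alpha\vee\beta$, $\beta\vdash\alpha\vee\beta$; $\alpha\vdash\gamma,\ \beta\vdash\gamma\,/\,\alpha\vee\beta\vdash\gamma$; $\alpha\wedge(\beta\vee\gamma)\vdash(\alpha\wedge\beta)\vee(\alpha\wedge\gamma)$; $\alpha\vdash\top$; $\bot\vdash\alpha$. Additional: $\alpha\vdash\beta\,/\,\sim\beta\vdash\sim\alpha$; $\sim\alpha\wedge\sim\beta\vdash\sim(\alpha\vee\beta)$; $\top\vdash\sim\bot$; $\alpha\wedge\beta\vdash\gamma\,/\,\alpha\wedge\sim\gamma\vdash\sim\beta$; $\alpha\wedge\sim\alpha\vdash\bot$; $\top\vdash\sim\alpha\vee\sim\sim\alpha$. A valuation in an algebra $A$ is a map $v$ from formulas to $A$ preserving $\vee,\wedge,\sim$ with $v(\bot)=0$, $v(\top)=1$. The consequent $\alpha\vdash\beta$ is valid in $A$ if $v(\alpha)\le v(\beta)$ for all valuations $v$ in $A$, and valid in a class of algebras if it is valid in each member. *)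

(* Defs.v *)
From HB Require Import structures.
From mathcomp Require Import all_boot all_order.
From mathcomp Require Import classical_sets.

Set Implicit Arguments.
Unset Strict Implicit.
Unset Printing Implicit Defensive.

Import Order.TTheory Order.CTheory.
Local Open Scope order_scope.

(* Together, meet_sim and sim_max say sim a = max {c | a `&` c = \bot}.
   \bot and \top are not required to be distinct. The choiceType carried by
   every lattice of the library is no restriction: classically every type has
   one (boolp.gen_eqMixin, boolp.gen_choiceMixin). *)
HB.mixin Record isStone (d : Order.disp_t) S of Order.TBDistrLattice d S := {
  sim : S -> S;
  meet_sim : forall a : S, a `&` sim a = \bot;
  sim_max : forall a c : S, a `&` c = \bot -> c <= sim a;
  stone_identity : forall a : S, sim a `|` sim (sim a) = \top
}.

#[short(type="stoneType")]
HB.structure Definition Stone d := { S of isStone d S & Order.TBDistrLattice d S }.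

Section BSquare.
Context (d : Order.disp_t) (B : ctbDistrLatticeType d).

Definition ordered_pair : pred (B *p B) := fun x => x.1 <= x.2.

(* The algebra B^[2] = {(a, b) in B^2 | a <= b}, as a bounded sublattice of the product lattice B *p B. *)
Record bsquare := BSquare { bpair : B *p B; _ : ordered_pair bpair }.

HB.instance Definition _ := [isSub for bpair].
HB.instance Definition _ := [Choice of bsquare by <:].

Fact ordered_pairI : meet_closed ordered_pair.
Proof. by move=> x y xP yP; exact: leI2. Qed.

Fact ordered_pairU : join_closed ordered_pair.
Proof. by move=> x y xP yP; exact: leU2. Qed.

Fact ordered_pair0 : \bot \in ordered_pair. Proof. exact: lexx. Qed.
Fact ordered_pair1 : \top \in ordered_pair. Proof. exact: lexx. Qed.

HB.instance Definition _ :=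
  Order.SubChoice_isTBSubLattice.Build _ _ _ (Order.prod_display d d) bsquare
    ordered_pairI ordered_pairU ordered_pair0 ordered_pair1.

Fact bsquare_meetUl : @left_distributive bsquare bsquare Order.meet Order.join.
Proof. by move=> x y z; apply: val_inj; exact: (@meetUl _ (B *p B)). Qed.

HB.instance Definition _ :=
  Order.Lattice_Meet_isDistrLattice.Build _ bsquare bsquare_meetUl.

Definition bsquare_sim (x : bsquare) : bsquare :=
  @BSquare (~` (bpair x).2, ~` (bpair x).2) (lexx (~` (bpair x).2)).

Fact bsquare_meet_sim (x : bsquare) : x `&` bsquare_sim x = \bot.
Proof.
apply: val_inj; have xle : (bpair x).1 <= (bpair x).2 := valP x; congr pair => /=.
  by apply/eqP; rewrite disj_leC complK.
exact: meetxC.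
Qed.

Fact bsquare_sim_max (x c : bsquare) : x `&` c = \bot -> c <= bsquare_sim x.
Proof.
move=> /(congr1 val) /(congr1 snd) /= /eqP; rewrite meetC disj_leC => c2.
by rewrite -Order.le_val; apply/andP; split=> //; exact: le_trans (valP c) c2.
Qed.

Fact bsquare_stone (x : bsquare) :
  bsquare_sim x `|` bsquare_sim (bsquare_sim x) = \top.
Proof. by apply: val_inj; congr pair; rewrite /= joinxC. Qed.

HB.instance Definition _ :=
  isStone.Build _ bsquare bsquare_meet_sim bsquare_sim_max bsquare_stone.

End BSquare.

(* Var n is the n-th propositional variable. *)
Inductive formula : Type :=
| Var of nat
| Top
| Bot
| Or of formula & formula
| And of formula & formula
| Neg of formula.

Reserved Notation "a |-S b" (at level 70, no associativity).

Inductive derivable : formula -> formula -> Prop :=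
| LS_refl a : a |-S a
| LS_trans a b c : a |-S b -> b |-S c -> a |-S c
| LS_andl a b : And a b |-S a
| LS_andr a b : And a b |-S b
| LS_and_intro a b c : a |-S b -> a |-S c -> a |-S And b c
| LS_orl a b : a |-S Or a b
| LS_orr a b : b |-S Or a b
| LS_or_elim a b c : a |-S c -> b |-S c -> Or a b |-S c
| LS_distr a b c : And a (Or b c) |-S Or (And a b) (And a c)
| LS_top a : a |-S Top
| LS_bot a : Bot |-S a
| LS_contra a b : a |-S b -> Neg b |-S Neg a
| LS_neg_or a b : And (Neg a) (Neg b) |-S Neg (Or a b)
| LS_neg_bot : Top |-S Neg Bot
| LS_antilogism a b c : And a b |-S c -> And a (Neg c) |-S Neg b
| LS_contradiction a : And a (Neg a) |-S Bot
| LS_stone a : Top |-S Or (Neg a) (Neg (Neg a))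
where "a |-S b" := (derivable a b).

Record valuation d (A : stoneType d) (v : formula -> A) : Prop := Valuation {
  valuation_or : forall a b, v (Or a b) = v a `|` v b;
  valuation_and : forall a b, v (And a b) = v a `&` v b;
  valuation_neg : forall a, v (Neg a) = sim (v a);
  valuation_bot : v Bot = \bot;
  valuation_top : v Top = \top
}.

Definition valid d (A : stoneType d) (a b : formula) : Prop :=
  forall v : formula -> A, valuation v -> v a <= v b.

(* Main.v *)
(* Let U be the set of prime theories T of the logic, and send a formula f to the
   pair ({T | f \in T}, {T | ~ f \notin T}). The Stone postulate makes this a
   valuation in P(U)^[2], and if a |- b is not derivable then a prime theory
   containing a but not b refutes it there. *)
Require Import Defs.
From mathcomp Require Import all_boot all_order.
From mathcomp Require Import boolp classical_sets.

Set Implicit Arguments.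
Unset Strict Implicit.
Unset Printing Implicit Defensive.

Import Order.TTheory.

Section StoneTheory.
Local Open Scope order_scope.
Context (d : Order.disp_t) (A : stoneType d).
Implicit Types x y z : A.

(** The defining property of the pseudocomplement as an equivalence, which turns inequalities below
    [sim x] into equations between meets. *)
Lemma le_sim x y : (y <= sim x) = (x `&` y == \bot).
Proof.
apply/idP/eqP => [yx | /sim_max //]; apply/eqP; rewrite -lex0.
by rewrite -(meet_sim x) leI2.
Qed.

Lemma sim_antilogism x y z : x `&` y <= z -> x `&` sim z <= sim y.
Proof.
move=> xyz; rewrite le_sim -lex0 meetA (meetC y) -(meet_sim z).
exact: leI2.
Qed.

Lemma sim_antitone x y : x <= y -> sim y <= sim x.
Proof. by move=> xy; rewrite -(meet1x (sim y)) sim_antilogism ?meet1x. Qed.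

Lemma soundness a b : a |-S b -> valid A a b.
Proof.
move=> ab v [vU vI vN v0 v1]; elim: ab => {a b}.
- by [].
- by move=> a b c _ + _; exact: le_trans.
- by move=> a b; rewrite vI leIl.
- by move=> a b; rewrite vI leIr.
- by move=> a b c _ ab _ ac; rewrite vI lexI ab ac.
- by move=> a b; rewrite vU leUl.
- by move=> a b; rewrite vU leUr.
- by move=> a b c _ ac _ bc; rewrite vU leUx ac bc.
- by move=> a b c; rewrite !(vI, vU) meetUr.
- by move=> a; rewrite v1 lex1.
- by move=> a; rewrite v0 le0x.
- by move=> a b _ ab; rewrite !vN sim_antitone.
- move=> a b; rewrite vI !vN vU le_sim meetUl meetA meet_sim meet0x join0x.
  by rewrite meetCA meet_sim meetx0.
- by rewrite vN v0 v1 le_sim meet0x.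
- by move=> a b c _; rewrite !vI !vN; exact: sim_antilogism.
- by move=> a; rewrite vI vN v0 meet_sim.
- by move=> a; rewrite vU !vN v1 stone_identity.
Qed.

End StoneTheory.

Section Derivations.
Implicit Types a b c : formula.

Lemma and_mono a a' b b' : a |-S a' -> b |-S b' -> And a b |-S And a' b'.
Proof.
by move=> aa' bb'; apply: LS_and_intro;
  [apply: LS_trans aa'; exact: LS_andl | apply: LS_trans bb'; exact: LS_andr].
Qed.

Lemma and_comm a b : And a b |-S And b a.
Proof. exact: LS_and_intro (LS_andr a b) (LS_andl a b). Qed.

(** Case analysis in a context [a]: [LS_or_elim] has no side formula, so distributivity carries the
    context into both branches. *)
Lemma or_elim_under a b c d :
  a |-S Or b c -> And a b |-S d -> And a c |-S d -> a |-S d.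
Proof.
move=> abc abd acd; apply: LS_trans (LS_or_elim abd acd).
by apply: LS_trans (LS_distr a b c); apply: LS_and_intro abc; exact: LS_refl.
Qed.

Lemma stone_under a b : a |-S Or (Neg b) (Neg (Neg b)).
Proof. exact: LS_trans (LS_top a) (LS_stone b). Qed.

(** This De Morgan law rests on the Stone postulate for [b]. The case [Neg b] is immediate; under
    [Neg (Neg b)], antilogism applied twice yields [Neg a]. *)
Lemma neg_and a b : Neg (And a b) |-S Or (Neg a) (Neg b).
Proof.
apply: or_elim_under (stone_under _ b) _ _.
  by apply: LS_trans (LS_orr _ _); exact: LS_andr.
apply: LS_trans (LS_orl _ _); apply: LS_antilogism.
apply: LS_trans (and_comm _ _) _.
exact/LS_antilogism/LS_refl.
Qed.

End Derivations.

Section PrimeTheories.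
Local Open Scope classical_set_scope.
Implicit Types (T X : set formula) (a b f g : formula).

Record theory T : Prop := Theory {
  theory_up : forall f g, f |-S g -> T f -> T g;
  theory_and : forall f g, T f -> T g -> T (And f g)
}.

Record prime_theory T : Prop := PrimeTheory {
  prime_theory_theory :> theory T;
  prime_theory_top : T Top;
  prime_theory_bot : ~ T Bot;
  prime_theory_or : forall f g, T (Or f g) -> T f \/ T g
}.

(** For a nonempty theory [X], the least theory containing [X] and [f]. A single [h] suffices
    because theories are closed under [And]. *)
Definition adjoin X f : set formula := [set g | exists2 h, X h & And h f |-S g].

Lemma theory_adjoin X f : theory X -> theory (adjoin X f).
Proof.
move=> [Xup XI]; split=> [g g' gg' [h Xh hg]|g g' [h Xh hg] [h' Xh' hg']].
  by exists h => //; exact: LS_trans gg'.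
exists (And h h'); first exact: XI.
apply: LS_and_intro; [apply: LS_trans hg|apply: LS_trans hg'].
  by apply: and_mono (LS_refl _); exact: LS_andl.
by apply: and_mono (LS_refl _); exact: LS_andr.
Qed.

Lemma sub_adjoin X f : X `<=` adjoin X f.
Proof. by move=> g Xg; exists g => //; exact: LS_andl. Qed.

Lemma mem_adjoin X f g : X g -> adjoin X f f.
Proof. by move=> Xg; exists g => //; exact: LS_andr. Qed.

(** The prime filter theorem: a theory maximal among those containing [a] and omitting [b] is prime,
    by distributivity. *)
Lemma prime_theory_separation a b : ~ a |-S b ->
  exists T, [/\ prime_theory T, T a & ~ T b].
Proof.
move=> nab.
(* Zorn_bigcup also asks about the empty chain, so the empty set must qualify:
   membership of a is only required of nonempty theories. *)
pose P X := [/\ theory X, forall f, X f -> X a & ~ X b].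
have [F FP Ftot|T [[Tth Ta Tb] Tmax]] := @Zorn_bigcup _ P.
  split; [split|..].
  - move=> f g fg [X FX Xf]; exists X => //.
    by have [Xth _ _] := FP _ FX; exact: theory_up fg Xf.
  - move=> f g [X FX Xf] [Y FY Yg]; have [XY|YX] := Ftot _ _ FX FY.
      exists Y => //; have [Yth _ _] := FP _ FY.
      exact: theory_and (XY _ Xf) Yg.
    exists X => //; have [Xth _ _] := FP _ FX.
    exact: theory_and Xf (YX _ Yg).
  - by move=> f [X FX Xf]; exists X => //; have [_ Xa _] := FP _ FX; exact: Xa Xf.
  - by move=> [X FX Xb]; have [_ _] := FP _ FX; exact.
(* If [a] were missing, [T] would be empty, and the principal theory of [a] would properly extend it
   while still omitting [b]. *)
have {}Ta : T a.
  apply: contrapT => nTa; apply: (Tmax [set f | a |-S f]).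
    split=> [f /Ta //|/(_ a (LS_refl a)) //].
  split=> //; last by move=> f _; exact: LS_refl.
  by split=> [f g fg af|f g]; [exact: LS_trans fg|exact: LS_and_intro].
have adj f : ~ T f -> adjoin T f b.
  move=> nTf; apply: contrapT => nb; apply: (Tmax (adjoin T f)).
    split; first exact: sub_adjoin.
    by move=> /(_ f (mem_adjoin f Ta)).
  by split=> // [|g _]; [exact: theory_adjoin|exact: sub_adjoin].
exists T; split=> //; split=> //.
- exact: theory_up (LS_top a) Ta.
- by move=> T0; apply/Tb; exact: theory_up (LS_bot b) T0.
(* If neither disjunct is in [T], each of them yields [b] together with some member of [T]; the
   conjunction of [Or f g], [h] and [k] then puts [b] in [T]. *)
- move=> f g Tfg; apply: contrapT => /not_orP[/adj[h Th hf] /adj[k Tk kg]].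
  apply/Tb/(theory_up Tth _ (theory_and Tth Tfg (theory_and Tth Th Tk))).
  apply: or_elim_under (LS_andl _ _) _ _.
    apply: LS_trans hf; apply: and_mono (LS_refl f).
    exact: LS_trans (LS_andr _ _) (LS_andl _ _).
  apply: LS_trans kg; apply: and_mono (LS_refl g).
  exact: LS_trans (LS_andr _ _) (LS_andr _ _).
Qed.

Section Membership.
Variables (T : set formula) (Tp : prime_theory T).

Lemma prime_theory_andE f g : T (And f g) <-> T f /\ T g.
Proof.
split=> [Tfg|[]]; last exact: (theory_and Tp).
by split; apply: (theory_up Tp) Tfg; do ?[exact: LS_andl|exact: LS_andr].
Qed.

Lemma prime_theory_orE f g : T (Or f g) <-> T f \/ T g.
Proof.
split=> [|[Tf|Tg]]; first exact: prime_theory_or.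
  exact: (theory_up Tp) (LS_orl f g) Tf.
exact: (theory_up Tp) (LS_orr f g) Tg.
Qed.

Lemma prime_theory_neg_orE f g : T (Neg (Or f g)) <-> T (Neg f) /\ T (Neg g).
Proof.
rewrite -prime_theory_andE; split; apply: (theory_up Tp).
  by apply: LS_and_intro; apply: LS_contra; [exact: LS_orl|exact: LS_orr].
exact: LS_neg_or.
Qed.

Lemma prime_theory_neg_andE f g : T (Neg (And f g)) <-> T (Neg f) \/ T (Neg g).
Proof.
rewrite -prime_theory_orE; split; apply: (theory_up Tp); first exact: neg_and.
by apply: LS_or_elim; apply: LS_contra; [exact: LS_andl|exact: LS_andr].
Qed.

Lemma prime_theory_consistent f : T f -> ~ T (Neg f).
Proof.
move=> Tf Tnf; apply: (prime_theory_bot Tp).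
exact: (theory_up Tp) (LS_contradiction f) (theory_and Tp Tf Tnf).
Qed.

(** Primeness and the Stone postulate give at least one of [Neg f] and [Neg (Neg f)], consistency at
    most one. *)
Lemma prime_theory_neg_negE f : T (Neg (Neg f)) <-> ~ T (Neg f).
Proof.
split=> [Tnnf Tnf|nTnf]; first exact: prime_theory_consistent Tnnf.
have /(prime_theory_or Tp)[//|//] : T (Or (Neg f) (Neg (Neg f))).
exact: (theory_up Tp) (LS_stone f) (prime_theory_top Tp).
Qed.

End Membership.

Definition prime_spectrum : Type := {T : set formula | prime_theory T}.

(** By [prime_theory_neg_negE] the second coordinate is also the set of prime theories containing
    [Neg (Neg f)]. *)
Definition canonical_pair f : set prime_spectrum *p set prime_spectrum :=
  ([set T | sval T f], [set T | ~ sval T (Neg f)]).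

Lemma canonical_pair_ordered f : ordered_pair (canonical_pair f).
Proof.
apply/subsetPset => -[T Tp] /=; exact: prime_theory_consistent.
Qed.

Definition canonical_valuation f : bsquare (set prime_spectrum) :=
  BSquare (canonical_pair_ordered f).

Lemma canonical_valuationP : valuation canonical_valuation.
Proof.
(* Each of the five equations becomes two, one per coordinate, compared at a single prime theory. *)
split=> [f g|f g|f||]; apply: val_inj; congr pair;
  apply/funext => -[T Tp]; apply/propext.
- exact: prime_theory_orE.
- by rewrite /= (prime_theory_neg_orE Tp) not_andP.
- exact: prime_theory_andE.
- by rewrite /= (prime_theory_neg_andE Tp) not_orP.
- by split=> [Tnf|/contrapT//]; apply.
- by rewrite /= (prime_theory_neg_negE Tp).
- by split=> // /(prime_theory_bot Tp).
- split=> // nTnB; apply: nTnB.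
  exact: (theory_up Tp) LS_neg_bot (prime_theory_top Tp).
- by split=> // _; exact: prime_theory_top Tp.
- by split=> // _; exact: prime_theory_consistent (prime_theory_top Tp).
Qed.

End PrimeTheories.

Lemma completeness a b :
  (forall U : Type, valid (bsquare (set U)) a b) -> a |-S b.
Proof.
move=> ab; apply: contrapT => /prime_theory_separation[T [Tp Ta nTb]].
(* The first coordinate alone gives the contradiction: [T] lies in that of [a] but not in that of
   [b]. *)
have := ab _ _ canonical_valuationP; rewrite -Order.le_val => /andP[+ _].
by move=> /subsetPset/(_ (exist _ T Tp) Ta).
Qed.

Theorem theorem6 (a b : formula) :
  [<-> derivable a b;
       forall (d : Order.disp_t) (A : stoneType d), valid A a b;
       forall (d : Order.disp_t) (B : ctbDistrLatticeType d),
         valid (bsquare B) a b;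
       forall U : Type, valid (bsquare (set U)) a b].
Proof.
tfae.
- by move=> ab d A; exact: soundness.
- by move=> ab d B; exact: ab.
- by move=> ab U; exact: ab.
- exact: completeness.
Qed.
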